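(* Let $\alpha>0$ and $A,B\in\mathbb{C}^{n\times n}$. Assume that $\mu\in\mathbb{C}$ with $\mathrm{Re}(\mu)\ge 1$ is such that $$\frac{\Gamma(1+\frac{\mu}{\alpha})}{\Gamma(1+\frac{\mu-1}{\alpha})}\in\mathrm{spec}(B)\quad\text{and}\quad\frac{\Gamma(1+\frac{\mu+p}{\alpha})}{\Gamma(1+\frac{\mu+p-1}{\alpha})}\notin\mathrm{spec}(B)\ \text{ for all integers }p\ge 1 .$$ Let $s_{0,\alpha}$ be an eigenvector of $B$ associated to the eigenvalue $\frac{\Gamma(1+\frac{\mu}{\alpha})}{\Gamma(1+\frac{\mu-1}{\alpha})}$. Then the formal power series $$y(z;\alpha)=\sum_{p=0}^{\infty}s_{p,\alpha}z^{(p+\mu)/\alpha},\qquad s_{p,\alpha}=\left(\frac{\Gamma(1+\frac{\mu+p}{\alpha})}{\Gamma(1+\frac{\mu+p-1}{\alpha})}I-B\right)^{-1}As_{p-1,\alpha}\quad(p\ge 1),$$ is the unique formal solution, in the form of a Floquet series $\sum_{p\ge 0}s_{p,\alpha}z^{(p+\mu)/\alpha}$ with the given $s_{0,\alpha}$, of the fractional hypergeometric system $$z^{1/\alpha}\,{}^{C}D_z^{1/\alpha}y(z)=(z^{1/\alpha}A+B)y(z).$$ In addition, if $\|\cdot\|$ is a submultiplicative matrix norm and there exists $C>0$ such that $$\sup_{p\ge 1}\left\|\left(\frac{\Gamma(1/\alpha)}{\mathrm{B}\big(1+\frac{\mu+p-1}{\alpha},\frac{1}{\alpha}\big)}I-B\right)^{-1}\right\|\le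 C,$$ then this formal Floquet solution is convergent.
   Context: $\Gamma$ is the Gamma function and $\mathrm{B}(x,y)=\frac{\Gamma(x)\Gamma(y)}{\Gamma(x+y)}$ is the Beta function (not to be confused with the matrix $B$). ${}^{C}D_z^{1/\alpha}$ is the Caputo fractional derivative of order $1/\alpha$; on the formal series considered here (where $\mathrm{Re}(\mu)\ge 1$) it acts termwise by $${}^{C}D_z^{1/\alpha}\Big(\sum_{p\ge 0}a_pz^{(p+\mu)/\alpha}\Big)=\sum_{p\ge 0}a_p\frac{\Gamma(1+\frac{p+\mu}{\alpha})}{\Gamma(1+\frac{p+\mu-1}{\alpha})}z^{(p+\mu-1)/\alpha},$$ and componentwise on vectors. The series $\sum_{p\ge 0}s_{p,\alpha}z^{(p+\mu)/\alpha}$ is called convergent if $\sum_{p\ge 0}s_{p,\alpha}w^p$ has a positive radius of convergence in $w$. $\mathrm{spec}(B)$ is the set of eigenvalues of $B$; $I$ is the identity matrix. *)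

(* Defs.v *)
From HB Require Import structures.
From mathcomp Require Import all_boot all_order all_algebra complex.
From mathcomp Require Import all_classical all_reals all_analysis.
Import Order.TTheory GRing.Theory Num.Theory.
Import numFieldNormedType.Exports.

Set Implicit Arguments.
Unset Strict Implicit.
Unset Printing Implicit Defensive.

Local Open Scope complex_scope.
Local Open Scope classical_set_scope.
Local Open Scope ring_scope.

(* t^z = exp(z ln t), principal value, for real t > 0. *)
Definition cpowR (R : realType) (t : R) (z : R[i]) : R[i] :=
  (t `^ complex.Re z * cos (complex.Im z * ln t)) +i*
  (t `^ complex.Re z * sin (complex.Im z * ln t)).

(* Euler's integral of t^(z-1) e^(-t), which is the Gamma function on the
   half-plane 0 < Re z; it carries no meaning elsewhere.  With 0 < alpha and
   1 <= Re mu, every value used below is taken in that half-plane. *)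
Definition Gamma (R : realType) (z : R[i]) : R[i] :=
  let f t := cpowR t (z - 1) * (expR (- t))%:C in
  (\int[lebesgue_measure]_(t in `]0%R, +oo[) complex.Re (f t)) +i*
  (\int[lebesgue_measure]_(t in `]0%R, +oo[) complex.Im (f t)).

Definition Beta (R : realType) (x y : R[i]) : R[i] :=
  Gamma x * Gamma y / Gamma (x + y).

Definition gamma_ratio (R : realType) (alpha : R) (nu : R[i]) : R[i] :=
  Gamma (1 + nu / alpha%:C) / Gamma (1 + (nu - 1) / alpha%:C).

(* A formal series in complex powers of z with coefficients in C^n is given by
   its coefficients: y e is the coefficient of z^e. *)
Definition fseries (R : realType) (n : nat) := R[i] -> 'cV[R[i]]_n.

(* The sum ranges over at most one index p, since p |-> (p + mu) / alpha is
   injective for alpha != 0. *)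
Definition floquet (R : realType) (n : nat) (alpha : R) (mu : R[i])
    (s : nat -> 'cV[R[i]]_n) : fseries R n :=
  fun e => \sum_(p \in [set p : nat | (p%:R + mu) / alpha%:C = e]) s p.

(* Multiplication by z^b. *)
Definition fmulz (R : realType) (n : nat) (b : R[i]) (y : fseries R n) :
    fseries R n :=
  fun e => y (e - b).

Definition fmulmx (R : realType) (n : nat) (M : 'M[R[i]]_n)
    (y : fseries R n) : fseries R n :=
  fun e => M *m y e.

(* Termwise Caputo derivative of order b:
   z^g |-> Gamma(1 + g) / Gamma(1 + g - b) z^(g - b), so that the coefficient
   of z^e in the derivative comes from g = e + b.  This is the Caputo derivative
   for series whose exponents g satisfy b <= Re g. *)
Definition fcaputo (R : realType) (n : nat) (b : R[i]) (y : fseries R n) :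
    fseries R n :=
  fun e => (Gamma (1 + (e + b)) / Gamma (1 + e)) *: y (e + b).

(* y solves z^(1/alpha) D^(1/alpha) y = (z^(1/alpha) A + B) y. *)
Definition formal_solution (R : realType) (n : nat) (alpha : R)
    (A B : 'M[R[i]]_n) (y : fseries R n) : Prop :=
  let b : R[i] := (alpha^-1)%:C in
  forall e : R[i],
    fmulz b (fcaputo b y) e = fmulz b (fmulmx A y) e + fmulmx B y e.

Fixpoint hyper_coef (R : realType) (n : nat) (alpha : R) (A B : 'M[R[i]]_n)
    (mu : R[i]) (s0 : 'cV[R[i]]_n) (p : nat) : 'cV[R[i]]_n :=
  if p is q.+1 then
    invmx ((gamma_ratio alpha (mu + p%:R))%:M - B)
      *m (A *m hyper_coef alpha A B mu s0 q)
  else s0.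

Definition eigenvector (R : realType) (n : nat) (B : 'M[R[i]]_n)
    (a : R[i]) (v : 'cV[R[i]]_n) : Prop :=
  v != 0 /\ B *m v = a *: v.

Record submultiplicative_norm (R : realType) (n : nat)
    (N : 'M[R[i]]_n -> R) : Prop := SubmultiplicativeNorm {
  smnorm_ge0 : forall M, 0 <= N M;
  smnorm_eq0 : forall M, N M = 0 -> M = 0;
  smnormZ : forall (a : R[i]) M, N (a *: M) = Normc.normc a * N M;
  smnormD : forall M1 M2, N (M1 + M2) <= N M1 + N M2;
  smnormM : forall M1 M2, N (M1 *m M2) <= N M1 * N M2
}.

(* R[i]^o is R[i] with the topology of its norm; column vectors carry the
   induced (entrywise) topology. *)
Definition convergence_radius (R : realType) (n : nat)
    (s : nat -> 'cV[R[i]]_n) : \bar R :=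
  ereal_sup [set (Normc.normc w)%:E | w in
    [set w : R[i] |
      cvgn (series (fun p => w ^+ p *: s p) : nat -> 'cV[R[i]^o]_n)]].

Definition floquet_convergent (R : realType) (n : nat)
    (s : nat -> 'cV[R[i]]_n) : Prop :=
  (0 < convergence_radius s)%E.

(* Main.v *)
Require Import Defs.
From HB Require Import structures.
From mathcomp Require Import all_boot all_order all_algebra complex.
From mathcomp Require Import all_classical all_reals all_analysis.
From mathcomp Require Import measurable_realfun ring lra.
Import Order.TTheory GRing.Theory Num.Theory.
Import numFieldNormedType.Exports.
Local Open Scope complex_scope.
Local Open Scope classical_set_scope.
Local Open Scope ring_scope.

(** Comparing the coefficients of z^((p + mu)/alpha) on both sides turns the
    differential system into a recurrence ([formal_solutionP]): writing r_p for
    the Gamma ratio at mu + p, a Floquet series with coefficients t_p is a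
    solution if and only if r_0 t_0 = B t_0 and
    (r_p - B) t_p = A t_(p-1) for every p >= 1.  All other exponents contribute
    the equation 0 = 0.  Since r_0 belongs to an eigenvector and no other r_p is
    an eigenvalue, r_p - B is invertible for p >= 1, so t_0 determines the
    whole sequence, which gives existence and uniqueness at once.

    For convergence, the quotient of Gamma and Beta values in the hypothesis is
    r_p again ([gamma_ratio_BetaE]), because Gamma(1/alpha) cancels.  The
    cancellation needs Gamma(1/alpha) != 0, and this is the only analytic fact
    about Gamma that the argument uses: for real x > 0 Euler's integral is
    finite and positive ([Gamma_real_neq0]).  Hence the resolvents
    (r_p - B)^-1 have norm at most C, and s_p grows no faster than
    (C N(A))^p up to a constant ([hyper_coef_convergent]); a geometric bound on
    the coefficients gives a positive radius of convergence
    ([floquet_convergent_geometric]).  The norm N only measures square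
    matrices, so each vector is replaced by the matrix with all columns equal
    to it; submultiplicativity alone makes N dominate every entry
    ([submult_norm_entry]). *)

(** * Euler's integral at a positive real argument *)

(** Raise 1 + t <= m (1 + t/m) <= m exp(t/m) to the power m. *)
Lemma powR1D_le_expR (R : realType) (m t : R) : 1 <= m -> 0 < t ->
  (1 + t) `^ m <= m `^ m * expR t.
Proof.
move=> m1 t0; have m0 : 0 < m by exact: lt_le_trans m1.
have le_base : 1 + t <= m * expR (t / m).
  apply: (@le_trans _ _ (m * (1 + t / m))).
    by rewrite mulrDr mulr1 mulrCA divff ?gt_eqF// mulr1 lerD2r.
  by rewrite ler_pM2l// expR_ge1Dx.
apply: (le_trans (ge0_ler_powR (ltW m0) _ _ le_base)).
- by rewrite nnegrE; lra.
- by rewrite nnegrE mulr_ge0 ?expR_ge0 ?ltW.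
- by rewrite powRM ?expR_ge0 ?(ltW m0)// -expRM mulfVK ?gt_eqF.
Qed.

Lemma is_derive_continuous (R : realType) (f : R -> R) (t l : R) :
  is_derive t 1 f l -> {for t, continuous f}.
Proof.
by move=> df; apply/differentiable_continuous/derivable1_diffP/ex_derive.
Qed.

(** Exhaust the half-line by compact intervals [1/k, k], where the fundamental
    theorem of calculus applies although g may be unbounded near 0, and pass to
    the limit by monotone convergence. *)
Lemma ge0_integral_itvoy_le (R : realType) (g F : R -> R) (M : R) :
  (forall t : R, 0 < t -> 0 <= g t) ->
  (forall t : R, 0 < t -> {for t, continuous g}) ->
  (forall t : R, 0 < t -> is_derive t 1 F (g t)) ->
  (forall t : R, 0 < t -> 0 <= F t <= M) ->
  (\int[lebesgue_measure]_(t in `]0%R, +oo[) (g t)%:E <= M%:E)%E.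
Proof.
move=> g0 gC dF FM.
pose D (k : nat) : set R := `[k.+2%:R^-1, k.+2%:R]%classic.
have Dlb (k : nat) : 0 < k.+2%:R^-1 :> R by rewrite invr_gt0.
have Dgt0 k t : D k t -> 0 < t.
  by rewrite /D/= in_itv/= => /andP[+ _]; exact: lt_le_trans.
have bigD : \bigcup_k D k = `]0, +oo[%classic.
  apply/seteqP; split=> [t [k _ /Dgt0]|t]; rewrite /= in_itv/= andbT// => t0.
  have tV0 : 0 < t^-1 by rewrite invr_gt0.
  pose m := (Num.bound t + Num.bound t^-1)%N.
  exists m => //; rewrite /D/= in_itv/=; apply/andP; split.
  - rewrite invf_ple ?posrE//; apply/ltW/(lt_le_trans (archi_boundP (ltW tV0))).
    by rewrite ler_nat /m -addn2 -addnA addnCA leq_addr.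
  - apply/ltW/(lt_le_trans (archi_boundP (ltW t0))).
    by rewrite ler_nat /m -addn2 -addnA leq_addr.
have ndD : {homo D : n m / (n <= m)%N >-> (n <= m)%O}.
  move=> k m km; apply/subsetPset => t; rewrite /D/= !in_itv/= => /andP[kt tk].
  apply/andP; split.
    by apply: le_trans kt; rewrite lef_pV2 ?posrE// ler_nat.
  by apply: (le_trans tk); rewrite ler_nat.
have mD k : measurable (D k) by exact: measurable_itv.
have mg k : measurable_fun (D k) (EFin \o g).
  apply/measurable_EFinP.
  apply: subspace_continuous_measurable_fun => //.
  by apply: continuous_in_subspaceT => t; rewrite inE => /Dgt0; exact: gC.
have gD0 k t : D k t -> (0 <= (g t)%:E)%E.
  by move=> /Dgt0/g0; rewrite lee_fin.
have := ge0_nondecreasing_set_cvg_integral (mu := lebesgue_measure)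
  ndD mD mg gD0.
rewrite bigD => cvgD; rewrite -(cvg_lim _ cvgD)//.
apply: lime_le; first by apply/cvg_ex; eexists; exact: cvgD.
apply: nearW => k.
have Fd t : 0 < t -> derivable F t 1.
  by move=> t0; apply: ex_derive; exact: dF.
have Fc t : 0 < t -> {for t, continuous F}.
  by move=> t0; apply/differentiable_continuous/derivable1_diffP/Fd.
rewrite (@continuous_FTC2 _ g F).
- rewrite -EFinB lee_fin.
  have /andP[+ _] := FM _ (Dlb k); have /andP[_] := FM k.+2%:R (ltr0Sn _ _).
  by lra.
- by rewrite (@lt_trans _ _ 1)// ?invf_lt1 ?ltr1n.
- by apply: continuous_in_subspaceT => t; rewrite inE => /Dgt0; exact: gC.
- split.
  + move=> t; rewrite in_itv/= => /andP[kt _]; apply: Fd; exact: lt_trans kt.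
  + by apply: cvg_at_right_filter; apply: Fc.
  + by apply: cvg_at_left_filter; apply: Fc.
- move=> t; rewrite in_itv/= => /andP[kt _].
  have t0 : 0 < t by exact: lt_trans kt.
  by rewrite derive1E; apply: derive_val; exact: dF.
Qed.

(** The majorant t^(x-1) (1 + t)^(-x-1) is, up to the factor x, the derivative
    of the bounded function (t / (1 + t))^x, so a single estimate controls the
    integrand both near 0 and near infinity. *)
Lemma euler_integrand_le (R : realType) (x t : R) : 0 < x -> 0 < t ->
  t `^ (x - 1) * expR (- t) <=
  (x + 1) `^ (x + 1) * (t `^ (x - 1) * (1 + t) `^ (- (x + 1))).
Proof.
move=> x0 t0.
rewrite mulrCA ler_pM2l ?powR_gt0// powRN expRN.
rewrite ler_pdivlMr ?powR_gt0//; last by lra.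
rewrite mulrC ler_pdivrMr ?expR_gt0//.
by apply: powR1D_le_expR => //; lra.
Qed.

Lemma euler_integral_fin (R : realType) (x : R) : 0 < x ->
  (\int[lebesgue_measure]_(t in `]0%R, +oo[)
     (t `^ (x - 1) * expR (- t))%:E < +oo)%E.
Proof.
(* F is an antiderivative of the majorant g, with values in [0, K / x]. *)
move=> x0; set K := (x + 1) `^ (x + 1).
pose g t := K * (t `^ (x - 1) * (1 + t) `^ (- (x + 1))).
pose F t := K / x * (t / (1 + t)) `^ x.
have K0 : 0 < K by rewrite powR_gt0//; lra.
have dF (t : R) : 0 < t -> is_derive t 1 F (g t).
  move=> t0; rewrite /F.
  have t1 : 0 < 1 + t by lra.
  have t1n0 : 1 + t != 0 by rewrite gt_eqF.
  have d0 : is_derive t 1 (fun u : R => 1 + u) 1.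
    apply: (is_derive_eq (is_deriveD (is_derive_cst _ _ _) (is_derive_id _ _))).
    by rewrite add0r.
  have d1 : is_derive t 1 (fun u : R => u / (1 + u)) ((1 + t) ^+ 2)^-1.
    apply: (is_derive_eq
      (is_deriveM (is_derive_id _ _) (is_deriveV t1n0 d0))).
    by rewrite /GRing.scale/=; field.
  have d2 : is_derive (t / (1 + t)) 1 (@powR R ^~ x)
      (x * (t / (1 + t)) `^ (x - 1)).
    by apply: is_derive1_powR; rewrite divr_gt0.
  have d3 := is_derive1_comp (g := fun u : R => u / (1 + u)) d2 d1.
  apply: (is_derive_eq (is_deriveZ (K / x) d3)).
  rewrite /g /GRing.scale/= powRM ?invr_ge0 ?(ltW t0) ?(ltW t1)//.
  rewrite -(powR_inv1 (ltW t1)) -powRrM -(powR_invn _ (ltW t1)).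
  transitivity (K * (t `^ (x - 1) *
      ((1 + t) `^ (-1 * (x - 1)) * (1 + t) `^ (- 2%:R)))).
    by field; rewrite gt_eqF.
  by rewrite -powRD ?t1n0 ?implybT//; congr (_ * (_ * _ `^ _)); ring.
have gC (t : R) : 0 < t -> {for t, continuous g}.
  move=> t0; apply: continuousM; first exact: cvg_cst.
  apply: continuousM; apply: is_derive_continuous; first exact: is_derive1_powR.
  apply: (@is_derive1_comp _ (@powR R ^~ (- (x + 1))) (fun u => 1 + u)).
  by apply: is_derive1_powR; lra.
have g_ge0 (t : R) : 0 < t -> 0 <= g t.
  by move=> t0; rewrite !mulr_ge0 ?powR_ge0 ?ltW.
have le_int : (\int[lebesgue_measure]_(t in `]0%R, +oo[)
     (t `^ (x - 1) * expR (- t))%:E <=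
     \int[lebesgue_measure]_(t in `]0%R, +oo[) (g t)%:E)%E.
  apply: ge0_le_integral => //=.
  - by move=> t _; rewrite lee_fin mulr_ge0 ?powR_ge0 ?expR_ge0.
  - apply: measurable_funTS; apply/measurable_EFinP.
    apply: measurable_funM => //.
    exact: measurableT_comp.
  - apply: measurable_funTS; apply/measurable_EFinP.
    apply: measurable_funM => //.
    apply: measurable_funM => //.
    apply: (measurableT_comp (measurable_powR _)) => //.
    exact: measurable_funD.
  - move=> t; rewrite in_itv/= andbT => t0; rewrite lee_fin.
    exact: euler_integrand_le.
apply: (le_lt_trans le_int).
apply: (@le_lt_trans _ _ (K / x)%:E); last by rewrite ltry.
apply: (@ge0_integral_itvoy_le _ g F) => // t t0.
rewrite /F; apply/andP; split.
  by rewrite !mulr_ge0 ?powR_ge0 ?invr_ge0 ?ltW.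
rewrite ler_piMr ?divr_ge0 ?(ltW K0) ?(ltW x0)//.
apply: (@le_trans _ _ (1 `^ x)); last by rewrite powR1.
have t1 : 0 < 1 + t by lra.
by apply: ge0_ler_powR;
  rewrite ?nnegrE ?divr_ge0 ?ler_pdivrMr ?(ltW x0) ?(ltW t0) ?(ltW t1)//; lra.
Qed.

Lemma euler_integral_gt0 (R : realType) (x : R) : 0 < x ->
  (0 < \int[lebesgue_measure]_(t in `]0%R, +oo[)
     (t `^ (x - 1) * expR (- t))%:E)%E.
Proof.
(* On [1, 2] the integrand is at least t^-1 exp(-t) >= exp(-2) / 2. *)
move=> x0; pose c : R := 2^-1 * expR (- 2).
have c0 : 0 < c by rewrite mulr_gt0 ?expR_gt0 ?invr_gt0.
have mf (D : set R) :
    measurable_fun D (fun t : R => (t `^ (x - 1) * expR (- t))%:E).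
  apply: measurable_funTS; apply/measurable_EFinP; apply: measurable_funM => //.
  exact: measurableT_comp.
apply: (@lt_le_trans _ _ (\int[lebesgue_measure]_(t in `[1%R, 2%R]) c%:E)%E).
  rewrite integral_cst//= lebesgue_measure_itv/= lte_fin ltr1n.
  rewrite -EFinD -EFinM lte_fin.
  by rewrite mulr_gt0//; lra.
apply: (@le_trans _ _ (\int[lebesgue_measure]_(t in `[1%R, 2%R])
     (t `^ (x - 1) * expR (- t))%:E)%E).
  apply: ge0_le_integral => //=; first by move=> t _; rewrite lee_fin ltW.
    exact: mf.
  move=> t; rewrite in_itv/= => /andP[t1 t2]; rewrite lee_fin.
  rewrite ler_pM ?expR_ge0 ?invr_ge0 ?ler_expR ?lerN2//.
  apply: (@le_trans _ _ (t `^ (-1))).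
    by rewrite powR_inv1 ?lef_pV2 ?posrE; lra.
  by rewrite ler_powR//; lra.
apply: ge0_subset_integral => //=.
- exact: mf.
- by move=> t _; rewrite lee_fin mulr_ge0 ?powR_ge0 ?expR_ge0.
- by move=> t; rewrite /= !in_itv/= andbT => /andP[t1 _]; lra.
Qed.

(** Real-valued integrals are 0 when the underlying extended-real integral is
    infinite, so finiteness is needed on top of positivity. *)
Lemma Gamma_real_neq0 (R : realType) (x : R) : 0 < x -> Gamma x%:C != 0.
Proof.
move=> x0; apply/negP => /eqP/(congr1 (@complex.Re R)).
have -> : complex.Re (Gamma x%:C) =
    \int[lebesgue_measure]_(t in `]0, +oo[) (t `^ (x - 1) * expR (- t)).
  apply: eq_Rintegral => t _.
  by rewrite /cpowR/= subr0 mul0r cos0 !mulr0 subr0 mulr1.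
rewrite /Rintegral.
move=> /eqP; rewrite fine_eq0; last first.
  rewrite ge0_fin_numE; first exact: euler_integral_fin.
  by apply: integral_ge0 => t _; rewrite lee_fin mulr_ge0 ?powR_ge0 ?expR_ge0.
apply/negP; rewrite gt_eqF//.
exact: euler_integral_gt0.
Qed.

(** The arguments of the Beta function add up to 1 + nu/alpha, and its factor
    Gamma(1/alpha), which is nonzero, cancels. *)
Lemma gamma_ratio_BetaE (R : realType) (alpha : R) (nu : R[i]) : 0 < alpha ->
  Gamma (alpha^-1)%:C / Beta (1 + (nu - 1) / alpha%:C) (alpha^-1)%:C =
  gamma_ratio alpha nu.
Proof.
move=> a0; have Gn0 : Gamma (alpha^-1)%:C != 0.
  by apply: Gamma_real_neq0; rewrite invr_gt0.
rewrite /gamma_ratio /Beta fmorphV -addrA mulrBl mul1r subrK in Gn0 *.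
by rewrite invf_div mulrCA invfM (mulrC _^-1) mulVKf.
Qed.

(** * Formal solutions and the recurrence on coefficients *)

Lemma floquet_coefE (R : realType) (n : nat) (alpha : R) (mu : R[i])
    (s : nat -> 'cV[R[i]]_n) (p : nat) : 0 < alpha ->
  floquet alpha mu s ((p%:R + mu) / alpha%:C) = s p.
Proof.
move=> a0; rewrite /floquet.
have aC0 : alpha%:C^-1 != 0 :> R[i].
  by rewrite invr_eq0 eq_complex/= eqxx andbT gt_eqF.
rewrite (_ : [set _ | _] = [set p]) ?fsbig_set1//.
apply/seteqP; split=> [q/= /(mulIf aC0)/addIr/eqP|q/= ->//].
by rewrite eqr_nat => /eqP.
Qed.

Lemma floquet_out (R : realType) (n : nat) (alpha : R) (mu : R[i])
    (s : nat -> 'cV[R[i]]_n) (e : R[i]) :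
  (forall p : nat, (p%:R + mu) / alpha%:C != e) -> floquet alpha mu s e = 0.
Proof.
move=> eN; rewrite /floquet (_ : [set _ | _] = set0) ?fsbig_set0//.
by apply/seteqP; split=> // p /= /eqP; rewrite (negPf (eN p)).
Qed.

(** Multiplication by z^(1/alpha) compensates the shift of exponents made by the
    derivative, so the coefficient of z^((p + mu)/alpha) involves t_p and
    t_(p-1) only; mu/alpha - 1/alpha is not an exponent of the series, whence
    the special first equation. *)
Lemma formal_solutionP (R : realType) (n : nat) (alpha : R)
    (A B : 'M[R[i]]_n) (mu : R[i]) (t : nat -> 'cV[R[i]]_n) : 0 < alpha ->
  formal_solution alpha A B (floquet alpha mu t) <->
  gamma_ratio alpha mu *: t 0%N = B *m t 0%N /\
  (forall p, gamma_ratio alpha (mu + p.+1%:R) *: t p.+1 =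
     A *m t p + B *m t p.+1).
Proof.
move=> a0.
have aC0 : alpha%:C != 0 :> R[i].
  by rewrite eq_complex/= eqxx andbT gt_eqF.
have bE : (alpha^-1)%:C = alpha%:C^-1 :> R[i] by rewrite fmorphV.
have expS p : (p.+1%:R + mu) / alpha%:C - alpha%:C^-1 = (p%:R + mu) / alpha%:C.
  rewrite -[in X in _ - X](mul1r alpha%:C^-1) -mulrBl.
  by rewrite -natr1 addrAC addrK.
have ratioE p : Gamma (1 + (p%:R + mu) / alpha%:C) /
    Gamma (1 + ((p%:R + mu) / alpha%:C - alpha%:C^-1)) =
    gamma_ratio alpha (mu + p%:R).
  by rewrite /gamma_ratio (addrC mu) mulrBl mul1r.
have exp0 p : (p%:R + mu) / alpha%:C != (0%:R + mu) / alpha%:C - alpha%:C^-1.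
  apply/eqP => /(congr1 (fun z => z * alpha%:C)).
  rewrite mulrBl !divfK// mulVf// add0r addrC => /addrI/eqP.
  by rewrite -subr_eq0 opprK natr1 pnatr_eq0.
rewrite /formal_solution /fmulz /fcaputo /fmulmx /= bE; split=> [sol|[H0 HS] e].
- split=> [|p].
  + have := sol ((0%:R + mu) / alpha%:C).
    rewrite subrK ratioE floquet_coefE// floquet_out//.
    by rewrite mulmx0 add0r addr0.
  + have := sol ((p.+1%:R + mu) / alpha%:C).
    by rewrite subrK ratioE expS !floquet_coefE.
- rewrite subrK.
  have [[p <-]|eN] :=
    pselect (exists p : nat, (p%:R + mu) / alpha%:C = e).
  + rewrite ratioE floquet_coefE//; case: p => [|p].
      by rewrite floquet_out// mulmx0 add0r addr0.
    by rewrite expS floquet_coefE.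
  + have out_e p : (p%:R + mu) / alpha%:C != e.
      by apply/eqP => pe; apply: eN; exists p.
    have out_eb p : (p%:R + mu) / alpha%:C != e - alpha%:C^-1.
      by apply/eqP; rewrite -expS => /addIr/eqP; rewrite (negPf (out_e _)).
    rewrite (floquet_out _ _ _ _ _ _ out_e) (floquet_out _ _ _ _ _ _ out_eb).
    by rewrite scaler0 !mulmx0 addr0.
Qed.

Lemma eigenvalueN_unitmx (F : fieldType) (n : nat) (B : 'M[F]_n) (a : F) :
  ~~ eigenvalue B a -> a%:M - B \in unitmx.
Proof.
rewrite /eigenvalue negbK /eigenspace kermx_eq0 row_free_unit => H.
by rewrite -opprB -scaleN1r unitmxZ// unitrN1.
Qed.

Lemma hyper_step_eq (F : fieldType) (n : nat) (a : F) (B : 'M[F]_n)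
    (v x : 'cV[F]_n) :
  a%:M - B \in unitmx ->
  a *: x = v + B *m x <-> x = invmx (a%:M - B) *m v.
Proof.
move=> uB; split=> [/eqP|->].
- rewrite -subr_eq -mul_scalar_mx -mulmxBl => /eqP <-.
  by rewrite mulKmx.
- by apply/eqP; rewrite -subr_eq -mul_scalar_mx -mulmxBl mulKVmx.
Qed.

(** * Geometric coefficient bounds and convergence *)

Lemma cvg_complex (R : realType) (u : nat -> R[i]) (a b : R) :
  (fun k => complex.Re (u k)) @ \oo --> a ->
  (fun k => complex.Im (u k)) @ \oo --> b ->
  (u : nat -> R[i]^o) @ \oo --> (a +i* b : R[i]^o).
Proof.
move=> /cvgrPdist_lt ua /cvgrPdist_lt ub; apply/cvgrPdist_lt => e e0.
(* A positive element of the complex field is a positive real. *)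
have /andP[/eqP ime ree] : (complex.Im e == 0) && (0 < complex.Re e).
  by move: e0; rewrite ltcE/= eq_sym.
have re2 : 0 < complex.Re e / 2 by lra.
near=> k.
rewrite (_ : e = (complex.Re e)%:C); last first.
  by rewrite [LHS](complexE e) ime/= mulr0 addr0.
have H1 : `|a - complex.Re (u k)| < complex.Re e / 2 by near: k; exact: ua.
have H2 : `|b - complex.Im (u k)| < complex.Re e / 2 by near: k; exact: ub.
have E : a +i* b - u k =
    (a - complex.Re (u k))%:C + 'i%C * (b - complex.Im (u k))%:C.
  apply/eqP; rewrite eq_complex; case: (u k) => c d/=.
  by apply/andP; split; apply/eqP; ring.
change (`|a +i* b - u k| < (complex.Re e)%:C :> R[i]); rewrite E.
apply: le_lt_trans (ler_normD _ _) _.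
rewrite normrM !normc_def/= !expr0n/= addr0 add0r expr1n sqrtr1.
rewrite !addr0 !sqrtr_sqr mul1r.
by rewrite -rmorphD ltcR/=; lra.
Unshelve. all: by end_near. Qed.

Lemma is_cvg_mx (T : ptopologicalType) (m n : nat) (u : nat -> 'M[T]_(m, n)) :
  (forall i j, cvgn (fun k => u k i j)) -> cvgn u.
Proof.
move=> cu.
have ul : forall ij : 'I_m * 'I_n, exists l : T,
    (fun k => u k ij.1 ij.2) @ \oo --> l.
  by move=> ij; move/cvg_ex: (cu ij.1 ij.2).
have [l lP] := boolp.choice ul.
apply/cvg_ex; exists (\matrix_(i, j) l (i, j)) => A [P nP PA].
suff : \forall k \near \oo, forall ij : 'I_m * 'I_n,
    P ij.1 ij.2 (u k ij.1 ij.2).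
  by apply: filterS => k Pk; apply: PA => i j; exact: (Pk (i, j)).
apply: filter_forall => -[i j]; apply: (lP (i, j)).
by have := nP i j; rewrite mxE.
Qed.

Lemma is_cvg_series_le_geometric (R : realType) (u : nat -> R) (c : R) :
  (forall p, `|u p| <= c * 2^-1 ^+ p) -> cvgn (series u).
Proof.
move=> uc; apply: (@normed_cvg R R^o u).
have c0 : 0 <= c by have := uc 0%N; rewrite expr0 mulr1; exact: le_trans.
apply: (series_le_cvg _ _ uc).
- by move=> p; exact: normr_ge0.
- by move=> p; rewrite mulr_ge0// exprn_ge0.
- apply: (@is_cvg_geometric_series R c 2^-1).
  by rewrite ger0_norm//; lra.
Qed.

Lemma normr_Re_le (R : realType) (z : R[i]) : `|complex.Re z| <= Normc.normc z.
Proof.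
case: z => a b /=; rewrite -sqrtr_sqr ler_sqrt ?addr_ge0 ?sqr_ge0//.
by rewrite lerDl sqr_ge0.
Qed.

Lemma normr_Im_le (R : realType) (z : R[i]) : `|complex.Im z| <= Normc.normc z.
Proof.
case: z => a b /=; rewrite -sqrtr_sqr ler_sqrt ?addr_ge0 ?sqr_ge0//.
by rewrite lerDr sqr_ge0.
Qed.

(** For w = 1 / (2 (q + 1)) the terms w^p s_p are O(2^-p), so the
    real and imaginary parts of every entry are absolutely convergent. *)
Lemma floquet_convergent_geometric (R : realType) (n : nat)
  (s : nat -> 'cV[R[i]]_n) (K : 'I_n -> R) (q : R) : 0 <= q ->
  (forall p i, Normc.normc (s p i 0) <= K i * q ^+ p) ->
  floquet_convergent s.
Proof.
move=> q0 sK; pose w := (2 * (q + 1))^-1.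
have q1 : 0 < 2 * (q + 1) by lra.
have w0 : 0 < w by rewrite invr_gt0.
have wq : w * q <= 2^-1.
  by rewrite mulrC ler_pdivrMr//; lra.
have K0 i : 0 <= K i.
  have := sK 0%N i; rewrite expr0 mulr1; apply: le_trans.
  by case: (s _ _ _) => a b; exact: sqrtr_ge0.
have normw : Normc.normc w%:C = w.
  by rewrite /= expr0n addr0 sqrtr_sqr gtr0_norm.
have term p i : Normc.normc (w%:C ^+ p * s p i 0) <= K i * 2^-1 ^+ p.
  rewrite Normc.normcM.
  have -> : Normc.normc (w%:C ^+ p) = w ^+ p.
    elim: p => [|p IH]; first by rewrite !expr0 Normc.normc1.
    by rewrite !exprS Normc.normcM IH normw.
  apply: (@le_trans _ _ (w ^+ p * (K i * q ^+ p))).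
    by rewrite ler_pM2l ?exprn_gt0.
  by rewrite mulrCA ler_wpM2l// -exprMn lerXn2r// nnegrE ?mulr_ge0// ltW.
apply: (@lt_le_trans _ _ w%:E); first by rewrite lte_fin.
apply: ereal_sup_ubound; exists w%:C; last by rewrite normw.
apply: is_cvg_mx => i j; rewrite ord1.
have cRe : cvgn (series (fun p => complex.Re (w%:C ^+ p * s p i 0))).
  apply: (@is_cvg_series_le_geometric _ _ (K i)) => p.
  exact: le_trans (normr_Re_le _ _) (term p i).
have cIm : cvgn (series (fun p => complex.Im (w%:C ^+ p * s p i 0))).
  apply: (@is_cvg_series_le_geometric _ _ (K i)) => p.
  exact: le_trans (normr_Im_le _ _) (term p i).
move/cvg_ex : cRe => [a ca]; move/cvg_ex : cIm => [b cb].
apply/cvg_ex; exists (a +i* b : R[i]^o); apply: cvg_complex.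
- move: ca; apply: cvg_trans; apply: near_eq_cvg; apply: nearW => k /=.
  rewrite /series/= summxE raddf_sum.
  by apply: eq_bigr => p _; rewrite mxE.
- move: cb; apply: cvg_trans; apply: near_eq_cvg; apply: nearW => k /=.
  rewrite /series/= summxE raddf_sum.
  by apply: eq_bigr => p _; rewrite mxE.
Qed.

(** Sandwiching M between elementary matrices isolates one entry,
    E_ii M E_ji = M_ij E_ii; take norms and divide by N(E_ii) > 0. *)
Lemma submult_norm_entry (R : realType) (n : nat) (N : 'M[R[i]]_n -> R)
  (M : 'M[R[i]]_n) (i j : 'I_n) : submultiplicative_norm N ->
  Normc.normc (M i j) <= N (delta_mx j i) * N M.
Proof.
move=> smN.
have E : delta_mx i i *m (M *m delta_mx j i) = M i j *: delta_mx i i.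
  rewrite -(mul_delta_mx (0 : 'I_1) i i) -(mul_delta_mx (0 : 'I_1) j i).
  rewrite !mulmxA -(mulmxA _ _ M) -rowE -(mulmxA _ _ (delta_mx j 0)) -colE.
  by rewrite [col _ _]mx11_scalar -mulmxA mul_scalar_mx -scalemxAr !mxE.
have Nd0 : 0 < N (delta_mx i i).
  rewrite lt_neqAle smnorm_ge0// andbT.
  apply/negP => /eqP/esym/(smnorm_eq0 smN).
  by move=> /matrixP/(_ i i)/eqP; rewrite !mxE !eqxx oner_eq0.
rewrite -(ler_pM2r Nd0) -(smnormZ smN) -E mulrC.
apply: (le_trans (smnormM smN _ _)); rewrite ler_pM2l// mulrC.
exact: smnormM.
Qed.

Lemma hyper_coef_convergent (R : realType) (n : nat) (alpha : R)
    (A B : 'M[R[i]]_n) (mu : R[i]) (s0 : 'cV[R[i]]_n)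
    (N : 'M[R[i]]_n -> R) (C : R) : submultiplicative_norm N -> 0 <= C ->
  (forall p : nat,
     N (invmx ((gamma_ratio alpha (mu + p.+1%:R))%:M - B)) <= C) ->
  floquet_convergent (hyper_coef alpha A B mu s0).
Proof.
move=> smN C0 NC; set s := hyper_coef _ _ _ _ _.
(* N measures square matrices: repeat the vector s p in every column. *)
pose S p : 'M[R[i]]_n := s p *m const_mx 1.
have NS p : N (S p) <= N (S 0%N) * (C * N A) ^+ p.
  elim: p => [|p IH]; first by rewrite expr0 mulr1.
  have -> : S p.+1 =
      invmx ((gamma_ratio alpha (mu + p.+1%:R))%:M - B) *m (A *m S p).
    by rewrite /S /s/= !mulmxA.
  have -> : N (S 0%N) * (C * N A) ^+ p.+1 =
      C * (N A * (N (S 0%N) * (C * N A) ^+ p)) by rewrite exprS; ring.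
  apply: (le_trans (smnormM smN _ _)).
  apply: ler_pM; rewrite ?(smnorm_ge0 smN)//.
  apply: (le_trans (smnormM smN _ _)).
  by rewrite ler_wpM2l ?(smnorm_ge0 smN).
pose q := C * N A.
apply: (@floquet_convergent_geometric _ _ _
  (fun i => N (delta_mx i i) * N (S 0%N)) q).
  by rewrite mulr_ge0 ?(smnorm_ge0 smN).
move=> p i.
have -> : s p i 0 = S p i i.
  by rewrite /S mxE big_ord1 mxE mulr1.
apply: (le_trans (submult_norm_entry _ _ _ _ _ _ smN)).
by rewrite -mulrA ler_wpM2l ?(smnorm_ge0 smN).
Qed.

(** * The fractional hypergeometric system *)

Theorem corollary3p4 (R : realType) (n : nat) (alpha : R)
    (A B : 'M[R[i]]_n) (mu : R[i]) (s0 : 'cV[R[i]]_n)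
    (alpha_gt0 : 0 < alpha)
    (mu_ge1 : 1 <= complex.Re mu)
    (spec0 : eigenvalue B (gamma_ratio alpha mu))
    (specp : forall p : nat, (1 <= p)%N ->
       ~~ eigenvalue B (gamma_ratio alpha (mu + p%:R)))
    (s0_eig : eigenvector B (gamma_ratio alpha mu) s0) :
  let s := hyper_coef alpha A B mu s0 in
  (formal_solution alpha A B (floquet alpha mu s) /\
   (forall t : nat -> 'cV[R[i]]_n, t 0%N = s0 ->
      formal_solution alpha A B (floquet alpha mu t) ->
      forall p, t p = s p)) /\
  (forall N : 'M[R[i]]_n -> R, submultiplicative_norm N ->
     (exists2 C : R, 0 < C &
        (ereal_sup [set (N (invmx
             ((Gamma (alpha^-1)%:C /
               Beta (1 + (mu + p%:R - 1) / alpha%:C) (alpha^-1)%:C)%:M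
              - B)))%:E | p in [set p : nat | (1 <= p)%N]] <= C%:E)%E) ->
     floquet_convergent s).
Proof.
move=> s.
have uB p : (gamma_ratio alpha (mu + p.+1%:R))%:M - B \in unitmx.
  by apply: eigenvalueN_unitmx; apply: specp.
split; first split.
- apply/formal_solutionP => //; split; first by case: s0_eig => _ ->.
  by move=> p; apply/hyper_step_eq.
- move=> t t0 /formal_solutionP[//|_ tS]; elim=> [//|p IH].
  by rewrite /s/= -/s -IH; apply/hyper_step_eq => //; exact: tS.
- move=> N smN [C C0 HC].
  apply: (hyper_coef_convergent _ _ _ _ _ _ _ _ C smN (ltW C0)) => p.
  rewrite -lee_fin; apply: le_trans HC.
  apply: ereal_sup_ubound; exists p.+1 => //.
  by rewrite gamma_ratio_BetaE.
Qed.
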